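(* Let $0\le\eta<1$, let $\tau_0$ be a real threshold, and let $\mathcal C^\star\in\mathcal B_B$ be an optimal feasible base, i.e. a maximizer of $v$ over $\mathcal B_B$. Consider an adaptive path with bases $\mathcal C_0,\dots,\mathcal C_{T-1}\in\mathcal B_B$ and step lengths $s_0,\dots,s_{T-1}\ge0$, as described in the context. Suppose that $\tau_t\ge\tau_0$ and $\mathcal R_t(s_t)\le\eta s_tD_t$ for every $t=0,\dots,T-1$, and that $\sum_{t=0}^{T-1}s_t=1$. Then $$\widetilde v(\boldsymbol x_T)\ \ge\ \left[1-e^{-(1-\eta)\tau_0}\right]v(\mathcal C^\star).$$
   Context: **Frame potential game.** Let $R\ge1$. For $r=1,\dots,R$ let $\mathbf U_r\in\mathbb R^{N_r\times K_r}$ have full column rank, with $i$th row $(\boldsymbol u_i^{(r)})^\top$, and let $\mathcal N_r=\{1,\dots,N_r\}$, $N_\Sigma=\sum_rN_r$. For $\mathcal S\subseteq\mathcal N_r$ put $F_r(\mathcal S)=\sum_{i,j\in\mathcal S}((\boldsymbol u_i^{(r)})^\top\boldsymbol u_j^{(r)})^2$, and $Z_r=F_r(\mathcal N_r)$. The ground set is $\mathcal E=\bigcup_{r}(\{r\}\times\mathcal N_r)$; for $\mathcal C\subseteq\mathcal E$ let $\mathcal C_r=\{i:(r,i)\in\mathcal C\}$ and $v(\mathcal C)=1-\prod_{r}F_r(\mathcal N_r\setminus\mathcal C_r)/\prod_rZ_r$. **Feasible bases.** Integers $\kappa_r$ with $K_r\le\kappa_r\le N_r$ and an integer $L$ with $\sum_r\kappa_r\le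 L\le N_\Sigma$ are given; $B=N_\Sigma-L$ and $\mathcal B_B=\{\mathcal C\subseteq\mathcal E:|\mathcal C|=B,\ |\mathcal C_r|\le N_r-\kappa_r\ \forall r\}$. **Multilinear extension.** For $\boldsymbol x\in[0,1]^{\mathcal E}$ (entries $x_i^{(r)}$) put $\boldsymbol y=\boldsymbol 1-\boldsymbol x$, $a_i^{(r)}=\|\boldsymbol u_i^{(r)}\|_2^4$, $b_i^{(r)}=\sum_{j\ne i}((\boldsymbol u_i^{(r)})^\top\boldsymbol u_j^{(r)})^2$, $H_r(\boldsymbol x)=\sum_ia_i^{(r)}y_i^{(r)}+\sum_{i\ne j}((\boldsymbol u_i^{(r)})^\top\boldsymbol u_j^{(r)})^2y_i^{(r)}y_j^{(r)}$ and $\widetilde v(\boldsymbol x)=1-\prod_rH_r(\boldsymbol x)/Z_r$ (the multilinear extension of $v$). For $e=(r,i)$ let $g_e(\boldsymbol x)=\partial\widetilde v/\partial x_i^{(r)}(\boldsymbol x)$, and for $\mathcal C\subseteq\mathcal E$ let $g(\mathcal C)=\sum_{e\in\mathcal C}g_e(\boldsymbol x)$ at the current state $\boldsymbol x$. **Gradient intervals at $\boldsymbol x$.** Put $\gamma_r=\frac1{Z_r}\prod_{s\ne r}\frac{H_s(\boldsymbol x)}{Z_s}$, $\bar y_r=\frac1{N_r}\sum_iy_i^{(r)}$, $\Delta_r=\max_i|y_i^{(r)}-\bar y_r|$, $d_i^{(r)}=\|\boldsymbol u_i^{(r)}\|_2^2$, $\mathbf G_r=\mathbf U_r^\top\operatorname{diag}(\boldsymbol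 y^{(r)})\mathbf U_r$, $\mathbf M_r=\mathbf G_r-\bar y_r\mathbf U_r^\top\mathbf U_r$, $\mu_r=\operatorname{tr}(\mathbf M_r)/K_r$, $\mathbf R_r=\mathbf M_r-\mu_r\mathbf I_{K_r}$. For $e=(r,i)$: $q_e^{\rm mean}=\gamma_r(a_i^{(r)}+2b_i^{(r)}\bar y_r)$, $\rho_e^{\rm mean}=2\gamma_rb_i^{(r)}\Delta_r$, $\widehat q_e=\gamma_r[a_i^{(r)}+2b_i^{(r)}\bar y_r+2\mu_rd_i^{(r)}-2a_i^{(r)}(y_i^{(r)}-\bar y_r)]$, $\rho_e=2\gamma_r\|\mathbf R_r\|_2d_i^{(r)}$ (spectral norm). The lower and upper bounds are $\ell_e=\max\{0,q_e^{\rm mean}-\rho_e^{\rm mean},\widehat q_e-\rho_e\}$ and $u_e=\min\{q_e^{\rm mean}+\rho_e^{\rm mean},\widehat q_e+\rho_e\}$, except that for each $e$ in some (arbitrary, possibly empty) set of exactly queried coordinates one sets $\ell_e=u_e=g_e(\boldsymbol x)$. **Certificate.** For $\mathcal A\in\mathcal B_B$ let $z_e(\mathcal A)=\ell_e$ if $e\in\mathcal A$ and $z_e(\mathcal A)=u_e$ otherwise; $\epsilon_{\mathcal A}=\max_{\mathcal C\in\mathcal B_B}\sum_{e\in\mathcal C}z_e(\mathcal A)-\sum_{e\in\mathcal A}\ell_e$; and $\tau_{\mathcal A}=g(\mathcal A)/(g(\mathcal A)+\epsilon_{\mathcal A})$ if $g(\mathcal A)+\epsilon_{\mathcal A}>0$,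 $\tau_{\mathcal A}=1$ otherwise. **Adaptive path.** Start at $\boldsymbol x_0=\boldsymbol0$. At step $t=0,\dots,T-1$ a base $\mathcal C_t\in\mathcal B_B$ and a step $s_t\ge0$ (at most the remaining path length $1-\sum_{j<t}s_j$) are accepted and $\boldsymbol x_{t+1}=\boldsymbol x_t+s_t\boldsymbol1_{\mathcal C_t}$, where $\boldsymbol 1_{\mathcal C}$ is the incidence vector. Put $D_t=g(\mathcal C_t)$ and $\tau_t=\tau_{\mathcal C_t}$, both computed at state $\boldsymbol x_t$ (with the set of queried coordinates of step $t$), and $\mathcal R_t(s)=sD_t-[\widetilde v(\boldsymbol x_t+s\boldsymbol1_{\mathcal C_t})-\widetilde v(\boldsymbol x_t)]$. *)

(* Defs.v *)
From mathcomp Require Import all_boot all_order all_algebra.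
From mathcomp Require Import all_classical all_reals all_analysis.

Set Implicit Arguments.
Unset Strict Implicit.
Unset Printing Implicit Defensive.

Import Order.TTheory GRing.Theory Num.Theory.
Import numFieldNormedType.Exports.
Local Open Scope ring_scope.

Section EuclideanNorms.
Context {R : realType}.

Definition dotv n (x y : 'cV[R]_n) : R := (x^T *m y) 0 0.

Definition norm2 n (x : 'cV[R]_n) : R := Num.sqrt (dotv x x).

Definition spectral_norm m n (A : 'M[R]_(m, n)) : R :=
  sup [set norm2 (A *m x) | x in [set x : 'cV[R]_n | norm2 x <= 1]]%classic.

End EuclideanNorms.

(* The family index r ranges over 'I_m; elements of the ground set are the
   dependent pairs (r, i) with i : 'I_(N r). *)
Notation ground N := {r : 'I_ _ & 'I_(N r)}.

Definition elt m (N : 'I_m -> nat) (r : 'I_m) (i : 'I_(N r)) : ground N :=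
  Tagged (fun r => 'I_(N r)) i.

Definition slice m (N : 'I_m -> nat) (C : {set ground N}) (r : 'I_m) :
    {set 'I_(N r)} :=
  [set i | elt i \in C].

Definition bases m (N : 'I_m -> nat) (kappa : 'I_m -> nat) (L : nat) :
    {set {set ground N}} :=
  [set C : {set ground N} | (#|C| == (\sum_r N r) - L)%N &
     [forall r, (#|slice C r| <= N r - kappa r)%N]].

Definition incidence (R : realType) (E : finType) (C : {set E}) :
    {ffun E -> R} :=
  [ffun e => (e \in C)%:R].

Section FramePotential.
Context {R : realType} {m : nat} {N K : 'I_m -> nat}.
Variable U : forall r : 'I_m, 'M[R]_(N r, K r).

Local Notation E := (ground N).
Local Notation state := {ffun E -> R}.

Definition frame_vec (r : 'I_m) (i : 'I_(N r)) : 'cV[R]_(K r) := (row i (U r))^T.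

Definition corr2 (r : 'I_m) (i j : 'I_(N r)) : R :=
  dotv (frame_vec i) (frame_vec j) ^+ 2.

Definition frame_pot (r : 'I_m) (S : {set 'I_(N r)}) : R :=
  \sum_(i in S) \sum_(j in S) corr2 i j.

Definition Ztot (r : 'I_m) : R := frame_pot [set: 'I_(N r)].

Definition game_value (C : {set E}) : R :=
  1 - (\prod_r frame_pot (~: slice C r)) / \prod_r Ztot r.

Definition ycoord (x : state) (r : 'I_m) (i : 'I_(N r)) : R := 1 - x (elt i).

Definition acoef (r : 'I_m) (i : 'I_(N r)) : R := norm2 (frame_vec i) ^+ 4.

Definition bcoef (r : 'I_m) (i : 'I_(N r)) : R :=
  \sum_(j | j != i) corr2 i j.

Definition dcoef (r : 'I_m) (i : 'I_(N r)) : R := norm2 (frame_vec i) ^+ 2.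

Definition Hval (x : state) (r : 'I_m) : R :=
  \sum_(i < N r) acoef i * ycoord x i +
  \sum_(i < N r) \sum_(j < N r | i != j) corr2 i j * ycoord x i * ycoord x j.

Definition multilinear_ext (x : state) : R := 1 - \prod_r (Hval x r / Ztot r).

(* The partial derivative at x in the coordinate e, taken with the library's
   derivative of the one-variable function h |-> v~(x + h 1_e) at 0. *)
Definition grad (x : state) (e : E) : R :=
  derive1 (fun h : R => multilinear_ext (x + h *: incidence R [set e])) 0.

Definition grad_sum (x : state) (C : {set E}) : R := \sum_(e in C) grad x e.

Section GradientIntervals.
Variable x : state.

Definition gammac (r : 'I_m) : R :=
  (Ztot r)^-1 * \prod_(s | s != r) (Hval x s / Ztot s).

Definition ybar (r : 'I_m) : R := (N r)%:R^-1 * \sum_(i < N r) ycoord x i.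

(* The default value 0 of the iterated maximum is harmless here: the terms are
   nonnegative. *)
Definition ydev (r : 'I_m) : R :=
  \big[Num.max/0]_(i < N r) `|ycoord x i - ybar r|.

Definition Gmat (r : 'I_m) : 'M[R]_(K r) :=
  (U r)^T *m diag_mx (\row_(i < N r) ycoord x i) *m U r.

Definition Mmat (r : 'I_m) : 'M[R]_(K r) :=
  Gmat r - ybar r *: ((U r)^T *m U r).

Definition muval (r : 'I_m) : R := \tr (Mmat r) / (K r)%:R.

Definition Rmat (r : 'I_m) : 'M[R]_(K r) := Mmat r - (muval r)%:M.

Definition q_mean (e : E) : R :=
  let i := tagged e in
  gammac (tag e) * (acoef i + 2 * bcoef i * ybar (tag e)).

Definition rho_mean (e : E) : R :=
  2 * gammac (tag e) * bcoef (tagged e) * ydev (tag e).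

Definition q_hat (e : E) : R :=
  let r := tag e in let i := tagged e in
  gammac r * (acoef i + 2 * bcoef i * ybar r + 2 * muval r * dcoef i
              - 2 * acoef i * (ycoord x i - ybar r)).

Definition rho_hat (e : E) : R :=
  2 * gammac (tag e) * spectral_norm (Rmat (tag e)) * dcoef (tagged e).

(* Q is the set of exactly queried coordinates. *)
Variable Q : {set E}.

Definition lower (e : E) : R :=
  if e \in Q then grad x e
  else Num.max 0 (Num.max (q_mean e - rho_mean e) (q_hat e - rho_hat e)).

Definition upper (e : E) : R :=
  if e \in Q then grad x e
  else Num.min (q_mean e + rho_mean e) (q_hat e + rho_hat e).

Definition zval (A : {set E}) (e : E) : R :=
  if e \in A then lower e else upper e.

(* A itself is one of the bases, so starting the iterated maximum from the
   value at A yields the maximum over the bases. *)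
Definition cert_gap (kappa : 'I_m -> nat) (L : nat) (A : {set E}) : R :=
  \big[Num.max/(\sum_(e in A) zval A e)]_(C in bases N kappa L)
     (\sum_(e in C) zval A e)
  - \sum_(e in A) lower e.

Definition cert_ratio (kappa : 'I_m -> nat) (L : nat) (A : {set E}) : R :=
  let D := grad_sum x A in
  let eps := cert_gap kappa L A in
  if 0 < D + eps then D / (D + eps) else 1.

End GradientIntervals.

Definition residual (x : state) (C : {set E}) (s : R) : R :=
  s * grad_sum x C
  - (multilinear_ext (x + s *: incidence R C) - multilinear_ext x).

End FramePotential.

Fixpoint path_state (R : realType) (E : finType) (C : nat -> {set E})
    (s : nat -> R) (t : nat) : {ffun E -> R} :=
  if t is t'.+1 then path_state C s t' + s t' *: incidence R (C t') else 0.

(* Main.v *)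
Require Import Defs.
From mathcomp Require Import all_boot all_order all_algebra.
From mathcomp Require Import all_classical all_reals all_analysis.
From mathcomp Require Import ring lra.

Set Implicit Arguments.
Unset Strict Implicit.
Unset Printing Implicit Defensive.

Import Order.TTheory GRing.Theory Num.Theory.
Import numFieldNormedType.Exports.
Local Open Scope ring_scope.

(* In the variables y = 1 - x the game is v~ = 1 - P(y), where P is a
   multiaffine polynomial with nonnegative coefficients.  So v~ is monotone on
   the unit box, and its concavity along nonnegative directions gives
   v(Cstar) - v~(x) <= g(Cstar).  The intervals enclose the gradient: the first
   one by averaging y, the second one because the quadratic form of R_r at u_i
   is at most ||R_r|| ||u_i||^2.  Hence g(Cstar) <= g(C_t) + eps, so the
   certificate yields g(C_t) >= tau0 (v(Cstar) - v~(x_t)) when tau0 >= 0, and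
   along the path the gap v(Cstar) - v~(x_t) contracts by the factor
   1 - (1 - eta) tau0 s_t <= exp(- (1 - eta) tau0 s_t).  For tau0 <= 0 the
   claimed lower bound is nonpositive. *)

(** * Euclidean and spectral norm inequalities *)

Section EuclideanBounds.
Context {R : realType}.

Lemma dotvE n (x y : 'cV[R]_n) : dotv x y = \sum_k x k 0 * y k 0.
Proof. by rewrite /dotv mxE; apply: eq_bigr => k _; rewrite mxE. Qed.

Lemma dotv_ge0 n (x : 'cV[R]_n) : 0 <= dotv x x.
Proof. by rewrite dotvE sumr_ge0 // => k _; rewrite -expr2 sqr_ge0. Qed.

Lemma dotvC n (x y : 'cV[R]_n) : dotv x y = dotv y x.
Proof. by rewrite !dotvE; apply: eq_bigr => k _; rewrite mulrC. Qed.

Lemma norm2_ge0 n (x : 'cV[R]_n) : 0 <= norm2 x.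
Proof. exact: sqrtr_ge0. Qed.

Lemma norm2_sqr n (x : 'cV[R]_n) : norm2 x ^+ 2 = dotv x x.
Proof. by rewrite sqr_sqrtr ?dotv_ge0. Qed.

Lemma norm2Z n (a : R) (x : 'cV[R]_n) : norm2 (a *: x) = `|a| * norm2 x.
Proof.
rewrite /norm2 -sqrtr_sqr -sqrtrM ?sqr_ge0 //; congr Num.sqrt.
rewrite !dotvE mulr_sumr; apply: eq_bigr => k _; rewrite !mxE; ring.
Qed.

Lemma norm2_eq0 n (x : 'cV[R]_n) : norm2 x = 0 -> x = 0.
Proof.
move=> x0; have := norm2_sqr x; rewrite x0 expr0n /= dotvE => /esym/eqP.
rewrite psumr_eq0 => [/allP h|k _]; last by rewrite -expr2 sqr_ge0.
apply/matrixP => i j; rewrite ord1 mxE; apply/eqP.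
by have := h i (mem_index_enum _); rewrite mulf_eq0 orbb.
Qed.

Lemma dotv_sqr_le n (x y : 'cV[R]_n) : dotv x y ^+ 2 <= dotv x x * dotv y y.
Proof.
(* Lagrange's identity *)
have : 0 <= \sum_i \sum_j (x i 0 * y j 0 - x j 0 * y i 0) ^+ 2.
  by do 2!apply: sumr_ge0 => ? _; exact: sqr_ge0.
have -> : \sum_i \sum_j (x i 0 * y j 0 - x j 0 * y i 0) ^+ 2 =
    dotv x x * dotv y y + dotv y y * dotv x x - 2 * (dotv x y * dotv x y).
  rewrite !dotvE !big_distrlr /= mulr_sumr -big_split /= -sumrB.
  apply: eq_bigr => i _; rewrite mulr_sumr -big_split /= -sumrB.
  by apply: eq_bigr => j _; ring.
lra.
Qed.

Lemma dotv_abs_le n (x y : 'cV[R]_n) : `|dotv x y| <= norm2 x * norm2 y.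
Proof.
rewrite -(ler_pXn2r (n := 2)) ?nnegrE ?mulr_ge0 ?norm2_ge0 ?normr_ge0 //.
by rewrite real_normK ?num_real // exprMn !norm2_sqr dotv_sqr_le.
Qed.

Lemma norm2_mulmx_unit_le p n (A : 'M[R]_(p, n)) (x : 'cV[R]_n) :
  norm2 x <= 1 -> norm2 (A *m x) <= spectral_norm A.
Proof.
move=> x1; apply: sup_upper_bound; last by exists x.
split; first by exists (norm2 (A *m x)), x.
(* [sup] dominates its set only if that set is bounded; by Cauchy-Schwarz on each row, the Frobenius
   norm of [A] is a bound. *)
exists (Num.sqrt (\sum_i norm2 (row i A)^T ^+ 2)) => _ [z /= z1 <-].
rewrite [norm2 (A *m z)]/norm2 ler_wsqrtr // dotvE ler_sum // => i _.
have -> : (A *m z) i 0 = dotv (row i A)^T z.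
  by rewrite dotvE mxE; apply: eq_bigr => k _; rewrite !mxE.
rewrite -expr2 (le_trans (dotv_sqr_le _ _)) // -!norm2_sqr.
by rewrite ler_piMr ?sqr_ge0 // expr_le1 ?norm2_ge0.
Qed.

Lemma norm2_mulmx_le p n (A : 'M[R]_(p, n)) (x : 'cV[R]_n) :
  norm2 (A *m x) <= spectral_norm A * norm2 x.
Proof.
have [/norm2_eq0 ->|x0] := eqVneq (norm2 x) 0.
  have n0 k : norm2 (0 : 'cV[R]_k) = 0.
    by rewrite -(scale0r 0) norm2Z normr0 mul0r.
  by rewrite mulmx0 !n0 mulr0.
have xp : 0 < norm2 x by rewrite lt_def x0 norm2_ge0.
have := @norm2_mulmx_unit_le _ _ A ((norm2 x)^-1 *: x).
rewrite -scalemxAr !norm2Z ger0_norm ?invr_ge0 ?norm2_ge0 // mulVf //.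
by rewrite mulrC ler_pdivrMr // => ->.
Qed.

Lemma dotv_mulmx_le n (A : 'M[R]_n) (x : 'cV[R]_n) :
  `|dotv x (A *m x)| <= spectral_norm A * norm2 x ^+ 2.
Proof.
rewrite (le_trans (dotv_abs_le _ _)) // expr2 mulrCA.
by rewrite ler_wpM2l ?norm2_ge0 ?norm2_mulmx_le.
Qed.

End EuclideanBounds.

(** Tangent bound for the product over the families, by induction on the factors: lowered factors
    may be replaced by the larger [h]. *)
Lemma ler_prodB (R : realDomainType) (I : finType) (h h' : I -> R) :
  (forall i, 0 <= h' i <= h i) ->
  \prod_i h i - \prod_i h' i
    <= \sum_i (h i - h' i) * \prod_(j | j != i) h j.
Proof.
move=> hh; have h'0 i : 0 <= h' i by case/andP: (hh i).
have h'h i : h' i <= h i by case/andP: (hh i).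
have h0 i : 0 <= h i by exact: le_trans (h'h i).
elim: (index_enum I) (index_enum_uniq I) => [|x s IHs].
  by rewrite !big_nil subrr.
rewrite cons_uniq => /andP[xs us]; rewrite !big_cons eqxx /=.
have -> : \prod_(j <- s | j != x) h j = \prod_(j <- s) h j.
  rewrite big_seq_cond [RHS]big_seq; apply: eq_bigl => j.
  by case: (boolP (j \in s)) => //= js; apply: contraNneq xs => <-.
have -> : \sum_(i <- s) (h i - h' i) * \prod_(j <- x :: s | j != i) h j =
    h x * \sum_(i <- s) (h i - h' i) * \prod_(j <- s | j != i) h j.
  rewrite mulr_sumr big_seq [RHS]big_seq; apply: eq_bigr => i si.
  rewrite big_cons; have -> : x != i by apply: contraNneq xs => ->.
  ring.
have P' : \prod_(i <- s) h' i <= \prod_(i <- s) h i by apply: ler_prod.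
have := ler_wpM2l (h0 x) (IHs us).
(* The product of two nonnegative drops is exactly the slack left once the induction hypothesis is
   scaled by [h x]. *)
have : 0 <= (h x - h' x) * (\prod_(i <- s) h i - \prod_(i <- s) h' i).
  by rewrite mulr_ge0 ?subr_ge0.
lra.
Qed.

(** * The polynomials H_r as functions of y, and positivity of Z_r *)

Section FramePotentialTheory.
Context {R : realType} {m : nat} {N K : 'I_m -> nat}.
Variable U : forall r : 'I_m, 'M[R]_(N r, K r).

Local Notation E := (ground N).
Local Notation state := {ffun E -> R}.

Lemma corr2_ge0 r (i j : 'I_(N r)) : 0 <= corr2 U i j.
Proof. exact: sqr_ge0. Qed.

Lemma corr2C r (i j : 'I_(N r)) : corr2 U i j = corr2 U j i.
Proof. by rewrite /corr2 dotvC. Qed.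

Lemma acoef_corr2 r (i : 'I_(N r)) : acoef U i = corr2 U i i.
Proof. by rewrite /acoef /corr2 -norm2_sqr -exprM. Qed.

(* H_r as a function of y; the diagonal monomials stay linear (y_i, not y_i^2),
   which is what makes H_r multiaffine. *)
Definition pairH r (y : 'I_(N r) -> R) : R :=
  \sum_i \sum_j corr2 U i j * (if i == j then y i else y i * y j).

Lemma Hval_pairH (x : state) r : Hval U x r = pairH (@ycoord _ _ _ x r).
Proof.
rewrite /Hval /pairH -big_split; apply: eq_bigr => i _ /=.
rewrite [RHS](bigD1 i) //= eqxx acoef_corr2; congr (_ + _).
apply: eq_big => [j|j]; first by rewrite eq_sym.
by move=> /negPf ->; rewrite mulrA.
Qed.

(** Indicators are idempotent, so at the vertices of the cube the linear diagonal agrees with the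
    quadratic one; this ties v~ to v. *)
Lemma frame_pot_pairH r (S : {set 'I_(N r)}) :
  frame_pot U S = pairH (fun i => (i \in S)%:R).
Proof.
rewrite /frame_pot big_mkcond; apply: eq_bigr => i _ /=.
case: (boolP (i \in S)) => iS; last first.
  by rewrite big1 // => j _; case: eqP => _; rewrite ?mul0r mulr0.
rewrite big_mkcond; apply: eq_bigr => j _ /=.
case: eqVneq => [<-|_]; first by rewrite iS mulr1.
by rewrite mul1r; case: ifP; rewrite ?mulr1 ?mulr0.
Qed.

Lemma pairH_ge0 r (y : 'I_(N r) -> R) : (forall i, 0 <= y i) -> 0 <= pairH y.
Proof.
move=> y0; do 2!apply: sumr_ge0 => ? _; rewrite mulr_ge0 ?corr2_ge0 //.
by case: ifP => _; rewrite ?mulr_ge0.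
Qed.

Lemma le_pairH r (y y' : 'I_(N r) -> R) :
  (forall i, 0 <= y i <= y' i) -> pairH y <= pairH y'.
Proof.
move=> yy'; apply: ler_sum => i _; apply: ler_sum => j _.
rewrite ler_wpM2l ?corr2_ge0 //.
case/andP: (yy' i) => ? ?; case/andP: (yy' j) => ? ?.
by case: ifP => // _; rewrite ler_pM.
Qed.

(** The partial derivative of [pairH] in [y i]; the factor 2 counts each pair in both orders. *)
Definition dpairH r (y : 'I_(N r) -> R) (i : 'I_(N r)) : R :=
  acoef U i + 2 * \sum_(j | j != i) corr2 U i j * y j.

Lemma dpairH_ge0 r (y : 'I_(N r) -> R) i :
  (forall i, 0 <= y i) -> 0 <= dpairH y i.
Proof.
move=> y0; rewrite addr_ge0 ?acoef_corr2 ?corr2_ge0 // mulr_ge0 //.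
by apply: sumr_ge0 => j _; rewrite mulr_ge0 ?corr2_ge0.
Qed.

(** Brings a directional derivative into the double-sum shape of [pairH], so that the two can be
    compared term by term; the symmetry of [corr2] splits the factor 2. *)
Lemma sum_dpairH r (y w : 'I_(N r) -> R) :
  \sum_i w i * dpairH y i =
  \sum_i \sum_j corr2 U i j *
    (if i == j then w i else w i * y j + w j * y i).
Proof.
pose c i j := corr2 U i j * (if i == j then 0 else w i * y j).
have -> : \sum_i \sum_j corr2 U i j *
      (if i == j then w i else w i * y j + w j * y i) =
    \sum_i \sum_j corr2 U i j * (if i == j then w i else 0) +
    \sum_i \sum_j c i j + \sum_i \sum_j c j i.
  rewrite -!big_split; apply: eq_bigr => i _; rewrite -!big_split.
  apply: eq_bigr => j _; rewrite /c /= corr2C (eq_sym j) [corr2 U j i]corr2C.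
  by case: eqP => _; ring.
rewrite [X in _ + _ + X]exchange_big -!big_split; apply: eq_bigr => i _ /=.
rewrite -addrA -mulr2n /dpairH acoef_corr2 mulrDr; congr (_ + _).
  rewrite (bigD1 i) //= eqxx big1 ?addr0 1?mulrC // => j.
  by rewrite eq_sym => /negPf ->; rewrite mulr0.
rewrite [in RHS](bigD1 i) //= {1}/c eqxx mulr0 add0r -[RHS]mulr_natl.
rewrite mulrCA; congr (_ * _).
rewrite mulr_sumr; apply: eq_bigr => j.
by rewrite /c eq_sym => /negPf ->; rewrite mulrCA.
Qed.

(** Holds monomial by monomial: since [y <= 1], losing [y i] costs at most 1, and losing [y i * y j]
    with [i] in [S] costs at most [y j]. *)
Lemma pairH_zero_out r (y : 'I_(N r) -> R) (S : {set 'I_(N r)}) :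
  (forall i, 0 <= y i <= 1) ->
  pairH y - pairH (fun i => if i \in S then 0 else y i)
    <= \sum_(i in S) dpairH y i.
Proof.
move=> y01; rewrite [leRHS]big_mkcond /=.
under [leRHS]eq_bigr do rewrite -mulrb.
have -> : \sum_i dpairH y i *+ (i \in S) = \sum_i (i \in S)%:R * dpairH y i.
  by apply: eq_bigr => i _; rewrite mulr_natl.
rewrite sum_dpairH -sumrB ler_sum // => i _; rewrite -sumrB ler_sum // => j _.
rewrite -mulrBr ler_wpM2l ?corr2_ge0 //.
have := y01 i; have := y01 j.
by case: eqVneq => [<-|_]; case: (i \in S); rewrite ?mulr0n ?mulr1n //;
  try case: (j \in S); rewrite ?mulr0n ?mulr1n; nra.
Qed.

(** As no square of [y i] occurs, moving one coordinate leaves no second-order term. *)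
Lemma pairH_perturb r (y : 'I_(N r) -> R) (i : 'I_(N r)) (h : R) :
  pairH (fun j => y j - h * (j == i)%:R) = pairH y - h * dpairH y i.
Proof.
have -> : dpairH y i = \sum_j (j == i)%:R * dpairH y j.
  rewrite (bigD1 i) //= eqxx mul1r big1 ?addr0 // => j /negPf ->.
  by rewrite mul0r.
rewrite sum_dpairH mulr_sumr -sumrB; apply: eq_bigr => k _.
rewrite mulr_sumr -sumrB; apply: eq_bigr => l _.
case: (eqVneq k l) => [_|kl]; first by ring.
have [ki|_] := eqVneq k i; last by rewrite !mulr0n; ring.
have -> : l == i = false by rewrite -ki eq_sym (negPf kl).
by rewrite !mulr0n; ring.
Qed.

(** Every [corr2 U i i], the fourth power of a row norm, is one of the nonnegative summands; if the
    total vanished, so would all rows, against the positive rank. *)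
Lemma Ztot_gt0 r : (1 <= K r)%N -> \rank (U r) = K r -> 0 < Ztot U r.
Proof.
move=> K1 rkU; have corr_le (i : 'I_(N r)) : corr2 U i i <= Ztot U r.
  rewrite /Ztot /frame_pot (bigD1 i) ?inE //= (bigD1 i) ?inE //= -addrA.
  rewrite lerDl addr_ge0 // sumr_ge0 // => j _; first exact: corr2_ge0.
  by apply: sumr_ge0 => k _; exact: corr2_ge0.
rewrite lt_def; apply/andP; split; last first.
  by do 2!apply: sumr_ge0 => ? _; exact: corr2_ge0.
apply/eqP => Z0; suff U0 : U r = 0 by move: K1; rewrite -rkU U0 mxrank0.
apply/row_matrixP => i; rewrite row0 -[row i _]trmxK.
have : corr2 U i i = 0.
  by apply/eqP; rewrite eq_le corr2_ge0 -Z0 corr_le.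
rewrite -acoef_corr2 /acoef => /eqP; rewrite expf_eq0 /= => /eqP /norm2_eq0.
by rewrite /frame_vec => ->; rewrite trmx0.
Qed.

Definition in_box (x : state) := forall e, 0 <= x e <= 1.

Lemma ycoord01 (x : state) r (i : 'I_(N r)) :
  in_box x -> 0 <= ycoord x i <= 1.
Proof. by move=> /(_ (elt i)); rewrite /ycoord; lra. Qed.

(** * Monotonicity, gradient and concavity bound of v~ on the unit box *)

Section Nondegenerate.
Hypothesis Zpos : forall r, 0 < Ztot U r.

Lemma Hratio_ge0 x r : in_box x -> 0 <= Hval U x r / Ztot U r.
Proof.
move=> bx; rewrite divr_ge0 ?(ltW (Zpos r)) // Hval_pairH pairH_ge0 // => i.
by case/andP: (ycoord01 i bx).
Qed.

Lemma gammac_ge0 x r : in_box x -> 0 <= gammac U x r.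
Proof.
move=> bx; rewrite mulr_ge0 ?invr_ge0 ?(ltW (Zpos r)) //.
by apply: prodr_ge0 => s _; exact: Hratio_ge0.
Qed.

Lemma game_value_incidence (A : {set E}) :
  game_value U A = multilinear_ext U (incidence R A).
Proof.
rewrite /game_value /multilinear_ext -prodf_div; congr (1 - _).
apply: eq_bigr => r _; rewrite frame_pot_pairH Hval_pairH; congr (pairH _ / _).
apply/funext => i; rewrite /ycoord ffunE !inE.
by case: (elt i \in A); rewrite /= ?mulr0n ?mulr1n; lra.
Qed.

Lemma multilinear_ext0 : multilinear_ext U 0 = 0.
Proof.
rewrite /multilinear_ext big1 ?subrr // => r _.
have -> : Hval U 0 r = Ztot U r.
  rewrite Hval_pairH /Ztot frame_pot_pairH; congr pairH.
  by apply/funext => i; rewrite /ycoord ffunE inE subr0.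
by rewrite divff // gt_eqF.
Qed.

Lemma le_multilinear_ext (x x' : state) : (forall e, x e <= x' e <= 1) ->
  multilinear_ext U x <= multilinear_ext U x'.
Proof.
move=> xx'; rewrite lerD2l lerN2 ler_prod // => r _; apply/andP; split.
  rewrite divr_ge0 ?(ltW (Zpos r)) // Hval_pairH pairH_ge0 // => i.
  by have := xx' (elt i); rewrite /ycoord; lra.
rewrite ler_pM2r ?invr_gt0 // !Hval_pairH le_pairH // => i.
by have := xx' (elt i); rewrite /ycoord; lra.
Qed.

Lemma in_box_incidence (A : {set E}) : in_box (incidence R A).
Proof.
by move=> e; rewrite ffunE; case: (e \in A); rewrite ?mulr0n ?mulr1n; lra.
Qed.

Lemma game_value_ge0 (A : {set E}) : 0 <= game_value U A.
Proof.
rewrite game_value_incidence -multilinear_ext0 le_multilinear_ext // => e.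
by rewrite ffunE; exact: in_box_incidence.
Qed.

Lemma gradE x r (i : 'I_(N r)) :
  grad U x (elt i) = gammac U x r * dpairH (@ycoord _ _ _ x r) i.
Proof.
rewrite /grad derive1E.
apply: derive_val; apply/is_derive1_caratheodory.
(* v~ is affine along a coordinate, so its Caratheodory slope function is constant. *)
exists (cst (gammac U x r * dpairH (@ycoord _ _ _ x r) i)).
split => //; last exact: cvg_cst.
move=> h; have mlE k : multilinear_ext U (x + k *: incidence R [set elt i]) =
    1 - (Hval U x r - k * dpairH (@ycoord _ _ _ x r) i) / Ztot U r *
      \prod_(s | s != r) (Hval U x s / Ztot U s).
  rewrite /multilinear_ext (bigD1 r) //=; congr (1 - _ * _).
    rewrite !Hval_pairH -pairH_perturb; congr (pairH _ / _).
    apply/funext => j; rewrite /ycoord !ffunE inE /elt eq_Tagged /=.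
    by rewrite opprD addrA.
  apply: eq_bigr => s sr; rewrite !Hval_pairH; congr (pairH _ / _).
  apply/funext => j; rewrite /ycoord !ffunE inE.
  have /negPf -> : elt j != elt i.
    by apply: contra sr => /eqP /(congr1 (@tag _ _)) /= ->.
  by rewrite scaler0 addr0.
by rewrite !mlE /gammac /cst; ring.
Qed.

Lemma grad_ge0 x e : in_box x -> 0 <= grad U x e.
Proof.
move=> bx; case: e => r i; rewrite (gradE x i) mulr_ge0 ?gammac_ge0 //.
by apply: dpairH_ge0 => j; case/andP: (ycoord01 j bx).
Qed.

Lemma grad_sum_ge0 x (A : {set E}) : in_box x -> 0 <= grad_sum U x A.
Proof. by move=> bx; apply: sumr_ge0 => e _; exact: grad_ge0. Qed.

(* Compare x with x' = max(x, 1_A): v(A) <= v~(x') by monotonicity, and the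
   increment from x to x' is at most linear by concavity. *)
Lemma gap_le_grad_sum x (A : {set E}) : in_box x ->
  game_value U A - multilinear_ext U x <= grad_sum U x A.
Proof.
move=> bx; pose x' : state := [ffun e => if e \in A then 1 else x e].
have bx' : in_box x'.
  by move=> e; rewrite ffunE; case: ifP => // _; rewrite ler01 lexx.
have vA : game_value U A <= multilinear_ext U x'.
  rewrite game_value_incidence le_multilinear_ext // => e; rewrite !ffunE.
  by have := bx e; case: (e \in A); rewrite ?mulr0n ?mulr1n; lra.
apply: le_trans (lerB vA (lexx _)) _.
have y'E r : Hval U x' r = pairH (fun i : 'I_(N r) =>
    if i \in slice A r then 0 else ycoord x i).
  rewrite Hval_pairH; congr pairH; apply/funext => i.
  by rewrite /ycoord ffunE inE; case: ifP => // _; rewrite subrr.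
have y01 r (i : 'I_(N r)) := ycoord01 i bx.
rewrite /multilinear_ext opprD addrACA subrr add0r opprK addrC.
(* Concavity in two stages: [ler_prodB] linearizes the product over [r], then [pairH_zero_out]
   linearizes each factor. *)
apply: le_trans (ler_prodB _) _ => [r|].
  rewrite Hratio_ge0 //= ler_pM2r ?invr_gt0 // y'E Hval_pairH le_pairH // => i.
  by have /andP[? ?] := y01 _ i; case: ifP => _; rewrite ?lexx ?andbT.
rewrite /grad_sum.
have -> : \sum_(e in A) grad U x e =
    \sum_r \sum_(i in slice A r) grad U x (elt i).
  rewrite sig_big_dep; apply: eq_big => [[r i]|[r i] _] //.
  by rewrite inE.
apply: ler_sum => r _; under [leRHS]eq_bigr do rewrite gradE.
have -> : (Hval U x r / Ztot U r - Hval U x' r / Ztot U r) *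
      \prod_(s | s != r) (Hval U x s / Ztot U s) =
    gammac U x r * (Hval U x r - Hval U x' r) by rewrite /gammac; ring.
rewrite -mulr_sumr ler_wpM2l ?gammac_ge0 //.
by rewrite y'E Hval_pairH pairH_zero_out.
Qed.

End Nondegenerate.
End FramePotentialTheory.

(** * Enclosure of the gradient and the certificate *)

Section GradientIntervalsTheory.
Context {R : realType} {m : nat} {N K : 'I_m -> nat}.
Variable U : forall r : 'I_m, 'M[R]_(N r, K r).
Hypothesis Zpos : forall r, 0 < Ztot U r.

Local Notation E := (ground N).
Local Notation state := {ffun E -> R}.

Lemma frame_mulmxE r (i j : 'I_(N r)) :
  (U r *m frame_vec U i) j 0 = dotv (frame_vec U i) (frame_vec U j).
Proof.
by rewrite dotvC dotvE mxE; apply: eq_bigr => k _; rewrite !mxE.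
Qed.

(** Links the matrices of the spectral interval to the sums in the gradient: once [U r] is moved
    across, the entries of [U r *m frame_vec U i] are inner products with all rows. *)
Lemma dotv_gram r (i : 'I_(N r)) (d : 'rV[R]_(N r)) :
  dotv (frame_vec U i) ((U r)^T *m diag_mx d *m U r *m frame_vec U i) =
  \sum_j corr2 U i j * d 0 j.
Proof.
have -> : dotv (frame_vec U i) ((U r)^T *m diag_mx d *m U r *m frame_vec U i) =
    dotv (U r *m frame_vec U i) (diag_mx d *m (U r *m frame_vec U i)).
  by rewrite /dotv trmx_mul !mulmxA.
rewrite dotvE; apply: eq_bigr => j _.
by rewrite mul_diag_mx [X in _ * X]mxE frame_mulmxE /corr2; ring.
Qed.

Lemma dotv_Rmat (x : state) r (i : 'I_(N r)) :
  dotv (frame_vec U i) (Rmat U x r *m frame_vec U i) =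
  \sum_j corr2 U i j * (ycoord x j - ybar x r) - muval U x r * dcoef U i.
Proof.
have dotvBr n (u v w : 'cV[R]_n) : dotv u (v - w) = dotv u v - dotv u w.
  by rewrite /dotv mulmxBr !mxE.
have dotvZr n (a : R) (u v : 'cV[R]_n) : dotv u (a *: v) = a * dotv u v.
  by rewrite /dotv -scalemxAr mxE.
(* Unit weights let [dotv_gram] cover the mean term of [Mmat] as well. *)
have gram1 : (U r)^T *m U r = (U r)^T *m diag_mx (const_mx 1) *m U r.
  by rewrite diag_const_mx mulmx1.
rewrite /Rmat /Mmat /Gmat gram1 !mulmxBl !dotvBr mul_scalar_mx -scalemxAl.
rewrite !dotvZr !dotv_gram /dcoef norm2_sqr; congr (_ - _).
by rewrite mulr_sumr -sumrB; apply: eq_bigr => j _; rewrite !mxE; ring.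
Qed.

Section Interval.
Variable x : state.
Hypothesis bx : in_box x.

(** In the exact error, deviations of y from its mean replace y; each is at most [ydev], and their
    weights sum to [bcoef]. *)
Lemma grad_q_mean e : `|grad U x e - q_mean U x e| <= rho_mean U x e.
Proof.
case: e => r i; rewrite (gradE U x i) /q_mean /rho_mean /=.
have -> : gammac U x r * dpairH U (@ycoord _ _ _ x r) i -
      gammac U x r * (acoef U i + 2 * bcoef U i * ybar x r) =
    2 * gammac U x r * \sum_(j | j != i) corr2 U i j * (ycoord x j - ybar x r).
  under eq_bigr do rewrite mulrBr.
  by rewrite sumrB -mulr_suml -/(bcoef U i) /dpairH; ring.
have g2 : 0 <= 2 * gammac U x r by rewrite mulr_ge0 ?gammac_ge0.
rewrite normrM (ger0_norm g2) -[leRHS]mulrA ler_wpM2l //.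
rewrite (le_trans (ler_norm_sum _ _ _)) // mulr_suml ler_sum // => j _.
rewrite normrM ger0_norm ?corr2_ge0 // ler_wpM2l ?corr2_ge0 //.
exact: (le_bigmax _ (fun j : 'I_(N r) => `|ycoord x j - ybar x r|)).
Qed.

(** The error is [2 * gammac] times the quadratic form of [Rmat] at u_i. In [q_hat], the [muval]
    term restores the trace part removed from [Mmat], and the last term cancels the index j = i,
    which the form contains but the sum in the gradient omits. *)
Lemma grad_q_hat e : `|grad U x e - q_hat U x e| <= rho_hat U x e.
Proof.
case: e => r i; rewrite (gradE U x i) /q_hat /rho_hat /=.
have -> : gammac U x r * dpairH U (@ycoord _ _ _ x r) i -
      gammac U x r * (acoef U i + 2 * bcoef U i * ybar x r +
        2 * muval U x r * dcoef U i -
        2 * acoef U i * (ycoord x i - ybar x r)) =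
    2 * gammac U x r * dotv (frame_vec U i) (Rmat U x r *m frame_vec U i).
  rewrite dotv_Rmat (bigD1 i) //= -acoef_corr2.
  under [\sum_(j | j != i) corr2 U i j * (_ - _)]eq_bigr do rewrite mulrBr.
  by rewrite sumrB -mulr_suml -/(bcoef U i) /dpairH; ring.
have g2 : 0 <= 2 * gammac U x r by rewrite mulr_ge0 ?gammac_ge0.
rewrite normrM (ger0_norm g2) -[leRHS]mulrA ler_wpM2l //.
exact: dotv_mulmx_le.
Qed.

Variable Q : {set E}.

Lemma lower_le_grad e : lower U x Q e <= grad U x e.
Proof.
rewrite /lower; case: ifP => // _; rewrite !ge_max grad_ge0 //=.
have := grad_q_mean e; have := grad_q_hat e; rewrite !ler_norml.
by move=> /andP[? ?] /andP[? ?]; apply/andP; split; lra.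
Qed.

Lemma grad_le_upper e : grad U x e <= upper U x Q e.
Proof.
rewrite /upper; case: ifP => // _; rewrite le_min.
have := grad_q_mean e; have := grad_q_hat e; rewrite !ler_norml.
by move=> /andP[? ?] /andP[? ?]; apply/andP; split; lra.
Qed.

(** Common elements of [A] and [C] cancel on both sides; elements gained are bounded by [upper] and
    elements lost by [lower], which is how [zval] is chosen. *)
Lemma grad_sum_le_cert_gap kappa L (A C : {set E}) : C \in bases N kappa L ->
  grad_sum U x C <= grad_sum U x A + cert_gap U x Q kappa L A.
Proof.
move=> Cb; rewrite /cert_gap.
set M := \big[Num.max/_]_(_ in _) _.
have zM : \sum_(e in C) zval U x Q A e <= M.
  exact: (le_bigmax_cond _ (fun B : {set E} => \sum_(e in B) zval U x Q A e)).
suff : grad_sum U x C - grad_sum U x A <=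
    \sum_(e in C) zval U x Q A e - \sum_(e in A) lower U x Q e.
  by move: zM; lra.
rewrite /grad_sum [X in X - _ <= _]big_mkcond [X in _ - X <= _]big_mkcond.
rewrite [X in _ <= X - _]big_mkcond [X in _ <= _ - X]big_mkcond /= -!sumrB.
apply: ler_sum => e _; rewrite /zval.
have := lower_le_grad e; have := grad_le_upper e.
by case: (e \in A); case: (e \in C); lra.
Qed.

Lemma cert_ratio_grad_sum kappa L (A C : {set E}) (tau : R) :
  C \in bases N kappa L -> 0 <= tau -> tau <= cert_ratio U x Q kappa L A ->
  tau * grad_sum U x C <= grad_sum U x A.
Proof.
move=> Cb tau0; have CA := grad_sum_le_cert_gap A Cb; rewrite /cert_ratio.
case: ifPn => [D0|]; last first.
  (* Here the ratio has its default value 1; [D0] makes g(C) nonpositive, so 0 separates the two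
     sides. *)
  rewrite -leNgt => D0 _; rewrite (@le_trans _ _ 0) ?grad_sum_ge0 //.
  by rewrite mulr_ge0_le0 // (le_trans CA).
by rewrite ler_pdivlMr // => /(le_trans _); apply; rewrite ler_wpM2l.
Qed.

End Interval.
End GradientIntervalsTheory.

(** * Coordinate bounds along the path *)

Section Path.
Context {R : realType} {E : finType} {C : nat -> {set E}} {s : nat -> R}.
Context {T : nat}.
Hypothesis s_ge0 : forall t, (t < T)%N -> 0 <= s t.

(** Each step raises a coordinate by [s t] or not at all; with total length 1 this keeps the path in
    the unit box. *)
Lemma path_state_bounds t e : (t <= T)%N ->
  0 <= path_state C s t e <= \sum_(j < t) s j.
Proof.
elim: t => [|t IHt] tT; first by rewrite big_ord0 ffunE lexx.
have := IHt (ltnW tT); have := s_ge0 tT; rewrite big_ord_recr /= !ffunE.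
by case: (e \in C t); rewrite /GRing.scale /= ?mulr0n ?mulr1n; lra.
Qed.

Lemma sum_step_le t : (t <= T)%N -> \sum_(j < t) s j <= \sum_(j < T) s j.
Proof.
move=> tT; rewrite -!(big_mkord xpredT) /= [leRHS](big_cat_nat (n := t)) //=.
rewrite lerDl big_nat sumr_ge0 // => j /andP[_].
exact: s_ge0.
Qed.

End Path.

(** * Contraction of the gap along the path *)

Theorem theorem1 (R : realType) (m : nat) (m_ge1 : (1 <= m)%N)
  (N K : 'I_m -> nat) (K_ge1 : forall r, (1 <= K r)%N)
  (U : forall r : 'I_m, 'M[R]_(N r, K r))
  (U_full : forall r, \rank (U r) = K r)
  (kappa : 'I_m -> nat)
  (kappa_bounds : forall r, (K r <= kappa r <= N r)%N)
  (L : nat) (L_bounds : (\sum_r kappa r <= L <= \sum_r N r)%N)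
  (eta : R) (eta_bounds : 0 <= eta < 1) (tau0 : R)
  (Cstar : {set ground N}) (Cstar_base : Cstar \in bases N kappa L)
  (Cstar_opt : forall C : {set ground N}, C \in bases N kappa L ->
     game_value U C <= game_value U Cstar)
  (T : nat) (C : nat -> {set ground N}) (s : nat -> R)
  (Q : nat -> {set ground N})
  (C_base : forall t, (t < T)%N -> C t \in bases N kappa L)
  (s_ge0 : forall t, (t < T)%N -> 0 <= s t)
  (s_remaining : forall t, (t < T)%N -> s t <= 1 - \sum_(j < t) s j)
  (cert : forall t, (t < T)%N ->
     tau0 <= cert_ratio U (path_state C s t) (Q t) kappa L (C t))
  (curv : forall t, (t < T)%N ->
     residual U (path_state C s t) (C t) (s t)
       <= eta * s t * grad_sum U (path_state C s t) (C t))
  (s_total : \sum_(t < T) s t = 1) :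
  (1 - expR (- ((1 - eta) * tau0))) * game_value U Cstar
    <= multilinear_ext U (path_state C s T).
Proof.
have Zpos r := Ztot_gt0 (K_ge1 r) (U_full r).
pose v t := multilinear_ext U (path_state C s t).
set vs := game_value U Cstar; have vs0 : 0 <= vs by exact: game_value_ge0.
have bx t : (t <= T)%N -> in_box (path_state C s t).
  move=> tT e; have /andP[-> le_s] := path_state_bounds (C := C) s_ge0 e tT.
  by rewrite (le_trans le_s) // -s_total (sum_step_le s_ge0).
have eta1 : 0 < 1 - eta by move: eta_bounds; lra.
(* The residual is the loss against the linear gain s_t D_t, and [curv] caps it at the fraction
   [eta] of that gain. *)
have step t : (t < T)%N ->
    v t + (1 - eta) * s t * grad_sum U (path_state C s t) (C t) <= v t.+1.
  by move=> tT; have := curv _ tT; rewrite /residual /v /=; lra.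
have D0 t : (t < T)%N -> 0 <= grad_sum U (path_state C s t) (C t).
  by move=> tT; apply: (grad_sum_ge0 Zpos); exact: bx (ltnW tT).
have mono t : (t < T)%N -> v t <= v t.+1.
  move=> tT; apply: le_trans (step _ tT); rewrite lerDl.
  by rewrite !mulr_ge0 ?D0 ?s_ge0 // ltW.
have v0 : v 0 = 0 by exact: multilinear_ext0.
have [tau_le0|tau_gt0] := leP tau0 0.
  apply: (@le_trans _ _ 0).
    rewrite mulr_le0_ge0 // subr_le0 -[leLHS]expR0 ler_expR oppr_ge0.
    exact: mulr_ge0_le0 (ltW eta1) tau_le0.
  suff v_ge0 t : (t <= T)%N -> 0 <= v t by exact: v_ge0.
  elim: t => [|t IHt] tT; first by rewrite v0.
  by rewrite (le_trans (IHt _)) ?mono // ltnW.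
set c := (1 - eta) * tau0; have c0 : 0 < c by exact: mulr_gt0.
(* The exponent records the path length covered so far, so at [T] it becomes [- c]. *)
have gap t : (t <= T)%N -> vs - v t <= expR (- (c * \sum_(j < t) s j)) * vs.
  elim: t => [|t IHt] tT.
    by rewrite big_ord0 mulr0 oppr0 expR0 mul1r v0 subr0.
  have gap_t := IHt (ltnW tT).
  rewrite big_ord_recr /= [c * _]mulrDr [- (_ + c * s t)]opprD expRD.
  set e := expR (- (c * \sum_(j < t) s j)) in gap_t *.
  have e0 : 0 < e by exact: expR_gt0.
  have e1 : 0 < expR (- (c * s t)) by exact: expR_gt0.
  (* A negative gap stays negative because [v] increases. Otherwise the gap is a nonnegative factor
     by which 1 - c s_t <= exp(- c s_t) may be multiplied. *)
  have [vs_lt|vs_ge] := ltP (vs - v t) 0.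
    apply: (@le_trans _ _ 0); first by have := mono _ tT; lra.
    by rewrite !mulr_ge0 // ltW.
  have tx := bx _ (ltnW tT).
  have gradCs : vs - v t <= grad_sum U (path_state C s t) Cstar.
    exact: gap_le_grad_sum.
  have D_ge : tau0 * (vs - v t) <= grad_sum U (path_state C s t) (C t).
    have := cert_ratio_grad_sum Zpos tx Cstar_base (ltW tau_gt0) (cert _ tT).
    apply: le_trans.
    by rewrite ler_wpM2l // ltW.
  have eta_s : 0 <= (1 - eta) * s t by rewrite mulr_ge0 ?s_ge0 // ltW.
  have := ler_wpM2l eta_s D_ge; have := step _ tT => h1 h2.
  apply: (@le_trans _ _ ((1 - c * s t) * (vs - v t))).
    by rewrite /c; lra.
  apply: (@le_trans _ _ (expR (- (c * s t)) * (vs - v t))).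
    by rewrite ler_wpM2r // expR_ge1Dx.
  by rewrite [e * _]mulrC -[leRHS]mulrA ler_wpM2l // ltW.
by have := gap T (leqnn T); rewrite s_total mulr1 /v; lra.
Qed.
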